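(* Let $\Delta t>0$, let $\textbf{Scheme-a}$ and $\textbf{Scheme-b}$ be the implicit midpoint schemes for the two split subsystems (a) and (b) of the Vlasov–Ampère system defined in the context, and let $$\textbf{Scheme-4}(\Delta t):=\textbf{Scheme-a}(\Delta t/2)\,\textbf{Scheme-b}(\Delta t)\,\textbf{Scheme-a}(\Delta t/2).$$ Under periodic boundary conditions in $\mathbf x$ and vanishing boundary conditions in $\mathbf v$, if $(f^{n+1},\mathbf E^{n+1})=\textbf{Scheme-4}(\Delta t)(f^n,\mathbf E^n)$, then $TE_n=TE_{n+1}$, where $$2\,TE_n=\int_{\Omega_x}\int_{\Omega_v} f^n|\mathbf v|^2\,d\mathbf v\,d\mathbf x+\int_{\Omega_x}|\mathbf E^n|^2\,d\mathbf x.$$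
   Context: The Vlasov–Ampère system is $\partial_t f+\mathbf v\cdot\nabla_{\mathbf x}f+\mathbf E\cdot\nabla_{\mathbf v}f=0$, $\partial_t\mathbf E=-\mathbf J$, with $\mathbf J(\mathbf x,t)=\int_{\Omega_v}f\,\mathbf v\,d\mathbf v$, on $\Omega_x\times\Omega_v$ (both of the same dimension). It is split into (a) $\partial_t f+\mathbf v\cdot\nabla_{\mathbf x}f=0$, $\partial_t\mathbf E=0$, and (b) $\partial_t f+\mathbf E\cdot\nabla_{\mathbf v}f=0$, $\partial_t\mathbf E=-\mathbf J$. Only time is discretized; $f=f(\mathbf x,\mathbf v)$ (scalar) and $\mathbf E=\mathbf E(\mathbf x)$ (vector valued) are functions of continuous variables. $\textbf{Scheme-a}(\tau)$ maps $(f^{\rm old},\mathbf E^{\rm old})$ to $(f^{\rm new},\mathbf E^{\rm new})$ with $$\frac{f^{\rm new}-f^{\rm old}}{\tau}+\mathbf v\cdot\nabla_{\mathbf x}\frac{f^{\rm old}+f^{\rm new}}2=0,\qquad \mathbf E^{\rm new}=\mathbf E^{\rm old}.$$ $\textbf{Scheme-b}(\tau)$ maps $(f^{\rm old},\mathbf E^{\rm old})$ to $(f^{\rm new},\mathbf E^{\rm new})$ with $$\frac{f^{\rm new}-f^{\rm old}}{\tau}+\tfrac12(\mathbf E^{\rm old}+\mathbf E^{\rm new})\cdot\nabla_{\mathbf v}\frac{f^{\rm old}+f^{\rm new}}2=0,\qquad \frac{\mathbf E^{\rm new}-\mathbf E^{\rm old}}{\tau}=-\tfrac12(\mathbf J^{\rm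 old}+\mathbf J^{\rm new}),$$ where $\mathbf J^{\rm old/new}=\int_{\Omega_v}f^{\rm old/new}\mathbf v\,d\mathbf v$. The product of schemes denotes successive application (composition). Since the schemes are implicit, the statement concerns any functions satisfying these equations. Boundary conditions: $\Omega_x$ is a finite (periodic) box and all functions are periodic in $\mathbf x$; either $\Omega_v$ is a bounded domain and all approximations of $f$ (including intermediate ones) vanish on $\partial\Omega_v$, or $\Omega_v$ is the whole space and they tend to $0$ as $|\mathbf v|\to\infty$. All functions are smooth enough, and decay fast enough in $\mathbf v$, for the integrals to be finite and for integration by parts to be valid without boundary terms. *)

(* Defs.v *)
From HB Require Import structures.
From mathcomp Require Import all_boot all_order all_algebra.
From mathcomp Require Import all_classical all_reals all_analysis.

Set Implicit Arguments.
Unset Strict Implicit.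
Unset Printing Implicit Defensive.

Import Order.TTheory GRing.Theory Num.Theory.
Import numFieldNormedType.Exports.

Local Open Scope classical_set_scope.
Local Open Scope ring_scope.

Fact measure_rV_display : measure_display.
Proof. exact: default_measure_display. Qed.

Section measurable_rV.
Context {R : realType} (n : nat).

Let coors : 'I_n -> 'rV[R]_n -> measurableTypeR R := fun i v => v ord0 i.

Let rV_set0 : g_sigma_preimage coors set0.
Proof. exact: sigma_algebra0. Qed.

Let rV_setC A : g_sigma_preimage coors A -> g_sigma_preimage coors (~` A).
Proof. exact: sigma_algebraC. Qed.

Let rV_bigcup (F : _^nat) : (forall i, g_sigma_preimage coors (F i)) ->
  g_sigma_preimage coors (\bigcup_i (F i)).
Proof. exact: sigma_algebra_bigcup. Qed.

(* Generated by the coordinate projections, as the library's instance on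
   [n.-tuple T]. *)
HB.instance Definition _ := @isMeasurable.Build measure_rV_display
  'rV[R]_n (g_sigma_preimage coors) rV_set0 rV_setC rV_bigcup.

Lemma measurable_coord (i : 'I_n) :
  measurable_fun [set: 'rV[R]_n] (fun v : 'rV[R]_n => v ord0 i : measurableTypeR R).
Proof.
move=> _ Y mY; rewrite setTI; apply: sub_sigma_algebra => /=.
rewrite -bigcup_seq/=; exists i => /=; first by rewrite mem_index_enum.
by exists Y => //; rewrite setTI.
Qed.

Lemma measurable_fun_rV d (T : measurableType d) (f : T -> 'rV[R]_n) :
  (forall i, measurable_fun [set: T] (fun x => f x ord0 i : measurableTypeR R)) ->
  measurable_fun [set: T] f.
Proof.
move=> mf _ A mA; rewrite setTI.
have : (g_sigma_preimage (fun i x => f x ord0 i : measurableTypeR R)) (f @^-1` A).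
  have := g_sigma_preimage_comp coors f.
  move=> -> ; exists A => //.
  by rewrite setTI.
move: (f @^-1` A).
apply: smallest_sub; first exact: sigma_algebra_measurable.
move=> B; rewrite -bigcup_seq/= => -[i _ [C mC <-]].
exact: mf.
Qed.

End measurable_rV.

Section lebesgue_rV.
Context {R : realType}.

Definition cons_rV n (p : measurableTypeR R * 'rV[R]_n) : 'rV[R]_n.+1 :=
  row_mx (const_mx p.1 : 'rV[R]_1) p.2.

Definition uncons_rV n (v : 'rV[R]_n.+1) : measurableTypeR R * 'rV[R]_n :=
  (v ord0 ord0, rsubmx (v : 'rV_(1 + n))).

Lemma cons_rVK n : cancel (@cons_rV n) (@uncons_rV n).
Proof.
move=> [x v]; rewrite /uncons_rV /cons_rV /= row_mxKr.
congr pair; rewrite mxE.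
by case: split_ordP => j; [rewrite mxE|move/(congr1 val)].
Qed.

Lemma measurable_cons_rV n : measurable_fun setT (@cons_rV n).
Proof.
apply: measurable_fun_rV => i; rewrite /cons_rV.
case: (@split_ordP 1 n i) => j ->.
  rewrite (_ : (fun _ => _) = fst); first exact: measurable_fst.
  apply/funext => x; rewrite [LHS](row_mxEl (const_mx x.1 : 'rV[R]_1)).
  by rewrite mxE.
rewrite (_ : (fun _ => _) = (fun v : 'rV[R]_n => v ord0 j : measurableTypeR R) \o snd).
  by apply: measurableT_comp; [exact: measurable_coord|exact: measurable_snd].
by apply/funext => x; rewrite [LHS](row_mxEr (const_mx x.1 : 'rV[R]_1)).
Qed.

Lemma measurable_uncons_rV n : measurable_fun setT (@uncons_rV n).
Proof.
apply/measurable_fun_pairP; split; first exact: measurable_coord.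
apply: measurable_fun_rV => i /=.
rewrite [X in measurable_fun _ X](_ : _ =
    fun v : 'rV[R]_n.+1 => v ord0 (rshift 1 i)).
  exact: (@measurable_coord _ n.+1).
by apply/funext => v /=; rewrite mxE.
Qed.

Section step.
Context n (mu : {sigma_finite_measure set 'rV[R]_n -> \bar R}).
Local Open Scope ereal_scope.

Definition lebesgue_cons :=
  pushforward (@lebesgue_measure R \x mu) (@cons_rV n).

Let lebesgue_cons0 : lebesgue_cons set0 = 0.
Proof. by rewrite /lebesgue_cons /pushforward preimage_set0 measure0. Qed.

Let lebesgue_cons_ge0 A : 0 <= lebesgue_cons A.
Proof. exact: (measure_ge0 (@lebesgue_measure R \x mu)). Qed.

Let lebesgue_cons_sigma_additive : semi_sigma_additive lebesgue_cons.
Proof.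
move=> F mF tF mUF; rewrite /lebesgue_cons /pushforward preimage_bigcup.
have mpre A : measurable A -> measurable (@cons_rV n @^-1` A).
  by move=> mA; rewrite -[X in measurable X]setTI; exact: measurable_cons_rV.
apply: (@measure_semi_sigma_additive _ _ _ (@lebesgue_measure R \x mu)).
- by move=> k; exact: mpre.
- apply/trivIsetP => /= i j _ _ ij; rewrite -preimage_setI.
  by move/trivIsetP : tF => /(_ _ _ _ _ ij) ->//; rewrite preimage_set0.
- by rewrite -preimage_bigcup; exact: mpre.
Qed.

HB.instance Definition _ := isMeasure.Build _ _ _
  lebesgue_cons lebesgue_cons0 lebesgue_cons_ge0 lebesgue_cons_sigma_additive.

Let lebesgue_cons_sigma_finite : sigma_finite setT lebesgue_cons.
Proof.
have /sigma_finiteP[F [FT ndF Foo]] := sigma_finiteT (@lebesgue_measure R).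
have /sigma_finiteP[G [GT ndG Goo]] := sigma_finiteT mu.
exists (fun k => @uncons_rV n @^-1` (F k `*` G k)).
  rewrite -preimage_bigcup (_ : \bigcup_k _ = setT) ?preimage_setT//.
  apply/seteqP; split=> // -[x y] _ /=.
  have [k _ Fkx] : (\bigcup_k F k) x by rewrite -FT.
  have [l _ Gly] : (\bigcup_k G k) y by rewrite -GT.
  exists (maxn k l) => //; split.
  - by move: x Fkx; exact/subsetPset/ndF/leq_maxl.
  - by move: y Gly; exact/subsetPset/ndG/leq_maxr.
move=> k; have [mF Fk] := Foo k; have [mG Gk] := Goo k; split.
  rewrite -[X in measurable X]setTI.
  by apply: measurable_uncons_rV => //; exact: measurableX.
rewrite /lebesgue_cons /pushforward -comp_preimage.
rewrite (_ : _ \o _ = id); last by apply/funext => x; exact: cons_rVK.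
by rewrite preimage_id product_measure1E// lte_mul_pinfty// ge0_fin_numE.
Qed.

HB.instance Definition _ := Measure_isSigmaFinite.Build _ _ _
  lebesgue_cons lebesgue_cons_sigma_finite.

End step.

(* Lebesgue measure on R^n, by recursion on n: a point of R^(n+1) is a real
   number followed by a point of R^n. *)
Fixpoint lebesgue_rV n : {sigma_finite_measure set 'rV[R]_n -> \bar R} :=
  match n with
  | 0%N => \d_ (0 : 'rV[R]_0)
  | m.+1 => lebesgue_cons (lebesgue_rV m)
  end.

Definition box n (a b : 'rV[R]_n) : set 'rV[R]_n :=
  [set x | forall i, a ord0 i <= x ord0 i <= b ord0 i].

Lemma measurable_box n (a b : 'rV[R]_n) : measurable (box a b).
Proof.
rewrite (_ : box a b = \bigcap_(i in [set: 'I_n])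
    ((fun x : 'rV[R]_n => x ord0 i : measurableTypeR R) @^-1`
       `[a ord0 i, b ord0 i]%classic)).
  apply: fin_bigcap_measurable => // i _; rewrite -[X in measurable X]setTI.
  exact: measurable_coord.
apply/seteqP; split=> x /=; first by move=> xab i _ /=; rewrite in_itv/=.
by move=> xab i; have := xab i I; rewrite /= in_itv.
Qed.

Lemma lebesgue_rV_box n (a b : 'rV[R]_n) : (forall i, a ord0 i <= b ord0 i) ->
  lebesgue_rV n (box a b) = (\prod_(i < n) (b ord0 i - a ord0 i))%:E.
Proof.
elim: n a b => [|n IH] a b ab /=.
  by rewrite big_ord0 diracE mem_set// => -[].
rewrite /lebesgue_cons /pushforward /=.
pose a' := rsubmx (a : 'rV_(1 + n)); pose b' := rsubmx (b : 'rV_(1 + n)).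
have split0 (c : 'rV[R]_n.+1) i : c ord0 (lift ord0 i) =
    rsubmx (c : 'rV_(1 + n)) ord0 i.
  by rewrite mxE; congr (c _ _); exact/val_inj.
have -> : @cons_rV n @^-1` box a b =
    `[a ord0 ord0, b ord0 ord0]%classic `*` box a' b'.
  apply/seteqP; split=> -[x y] /=.
    move=> xyab; have E := @cons_rVK n (x, y); split=> /=.
      rewrite in_itv /=; have := xyab ord0.
      by have [-> _] := E.
    move=> i; have := xyab (lift ord0 i).
    by rewrite !split0; have [_ ->] := E.
  have E := @cons_rVK n (x, y).
  rewrite in_itv/= => -[xab yab] i; case: (unliftP ord0 i) => [j|] ->.
    by rewrite !split0; have [_ ->] := E.
  by have [-> _] := E.
rewrite [LHS](product_measure1E (@lebesgue_measure R) (lebesgue_rV n))//.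
- rewrite IH; last by move=> i; rewrite -!split0.
  rewrite [X in (X * _)%E](_ : _ = (b ord0 ord0 - a ord0 ord0)%:E).
    by rewrite big_ord_recl; under [in RHS]eq_bigr do rewrite !split0.
  apply: (etrans (lebesgue_measure_itv _)); rewrite /= lte_fin.
  have [//|ba] := ltP; rewrite (_ : b _ _ - _ = 0)//.
  by apply/eqP; rewrite subr_eq0 eq_le ba ab.
- exact: measurable_box.
Qed.

End lebesgue_rV.

Section vlasov_ampere.
Context {R : realType} {d : nat}.
Implicit Types (x v w : 'rV[R]_d) (g : 'rV[R]_d -> R)
  (f : 'rV[R]_d -> 'rV[R]_d -> R) (Omv : set 'rV[R]_d).

Local Notation mu := (@lebesgue_rV R d).

(* Euclidean inner product; [`|v|] is the library's sup norm on ['rV_d], hence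
   [|v|^2] in the energy is [vdot v v]. *)
Definition vdot v w : R := \sum_(i < d) v ord0 i * w ord0 i.

Definition unit_vec (i : 'I_d) : 'rV[R]_d := delta_mx ord0 i.

Definition partial (i : 'I_d) g x : R := 'D_(unit_vec i) g x.

Definition grad g x : 'rV[R]_d := \row_i partial i g x.

Record state := State {
  density : 'rV[R]_d -> 'rV[R]_d -> R ;
  efield : 'rV[R]_d -> 'rV[R]_d }.

Definition current Omv f x : 'rV[R]_d :=
  \row_i \int[mu]_(v in Omv) (f x v * v ord0 i).

Definition scheme_a Omv (tau : R) (old new : state) : Prop :=
  (forall x v, Omv v ->
     (density new x v - density old x v) / tau
     + vdot v (grad (fun y => (density old y v + density new y v) / 2) x) = 0)
  /\ (forall x, efield new x = efield old x).

Definition scheme_b Omv (tau : R) (old new : state) : Prop :=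
  (forall x v, Omv v ->
     (density new x v - density old x v) / tau
     + vdot (2^-1 *: (efield old x + efield new x))
         (grad (fun w => (density old x w + density new x w) / 2) v) = 0)
  /\ (forall x, tau^-1 *: (efield new x - efield old x) =
        - (2^-1 *: (current Omv (density old) x + current Omv (density new) x))).

Definition box_periodic (a b : 'rV[R]_d) (V : zmodType) (h : 'rV[R]_d -> V)
    : Prop :=
  forall i, periodic h ((b ord0 i - a ord0 i) *: unit_vec i).

Definition bounded_domain Omv : Prop :=
  [/\ open Omv, connected Omv, Omv !=set0 & bounded_set Omv].

(* [Omv] is open, so its boundary is [closure Omv `\` Omv]. The second condition
   is void for a bounded domain, and the first one for the whole space. *)
Definition vanishing Omv g : Prop :=
  (forall v, (closure Omv `\` Omv) v -> g v = 0) /\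
  (forall eps, 0 < eps ->
     exists M, forall v, Omv v -> M < `|v| -> `|g v| < eps).

(* "Smooth enough, and decaying fast enough": [f] is continuous up to the
   boundary and C^1 in the interior, the energy and the current are given by
   absolutely convergent integrals, and so is the integral of
   [|v|^2 df/dv_i] over [Omv], which appears when scheme (b) is tested against
   [|v|^2]. The field [E] only needs to be continuous: [|E|^2] is then integrable
   on the box. Only the values of [f x] on [closure Omv] matter. *)
Record admissible (a b : 'rV[R]_d) Omv (s : state) : Prop := {
  density_continuous :
    {within [set p : 'rV[R]_d * 'rV[R]_d | closure Omv p.2],
      continuous (fun p => density s p.1 p.2)} ;
  density_derivable_x : forall i x v, Omv v ->
    derivable (density s ^~ v) x (unit_vec i) ;
  density_derivable_v : forall i x v, Omv v ->
    derivable (density s x) v (unit_vec i) ;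
  partial_x_continuous : forall i x v, Omv v ->
    {for (x, v), continuous (fun p : 'rV[R]_d * 'rV[R]_d =>
      partial i (density s ^~ p.2) p.1)} ;
  partial_v_continuous : forall i x v, Omv v ->
    {for (x, v), continuous (fun p : 'rV[R]_d * 'rV[R]_d =>
      partial i (density s p.1) p.2)} ;
  density_periodic : forall v, Omv v -> box_periodic a b (density s ^~ v) ;
  density_vanishing : forall x, vanishing Omv (density s x) ;
  energy_integrable : (mu \x mu)%E.-integrable (box a b `*` Omv)
    (fun p => (density s p.1 p.2 * vdot p.2 p.2)%:E) ;
  current_integrable : forall x i, mu.-integrable Omv
    (fun v => (density s x v * v ord0 i)%:E) ;
  partial_v_integrable : forall x i, mu.-integrable Omv
    (fun v => (partial i (density s x) v * vdot v v)%:E) ;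
  efield_continuous : continuous (efield s) ;
  efield_periodic : box_periodic a b (efield s) }.

Definition scheme_comp (P : state -> Prop) (S1 S2 : state -> state -> Prop)
    (old new : state) : Prop :=
  exists s, [/\ P s, S1 old s & S2 s new].

(* The schemes are implicit, hence relations; the boundary conditions are also
   imposed on the intermediate approximations. *)
Definition scheme_4 (a b : 'rV[R]_d) Omv (dt : R) : state -> state -> Prop :=
  scheme_comp (admissible a b Omv) (scheme_a Omv (dt / 2))
    (scheme_comp (admissible a b Omv) (scheme_b Omv dt) (scheme_a Omv (dt / 2))).

Definition total_energy (a b : 'rV[R]_d) Omv (s : state) : R :=
  2^-1 * (\int[mu]_(x in box a b) \int[mu]_(v in Omv) (density s x v * vdot v v)
          + \int[mu]_(x in box a b) vdot (efield s x) (efield s x)).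

End vlasov_ampere.
Arguments state R d : clear implicits.

(* Main.v *)
(** For each density, the integral over the periodic box of a spatial derivative
    vanishes, and integration by parts in velocity gives
    [int |v|^2 df/dv_i = - 2 J_i]. Hence scheme (a) keeps the kinetic energy (and
    the field), while in scheme (b) the kinetic energy changes by
    [dt/2 (E_old + E_new) . (J_old + J_new) = |E_old|^2 - |E_new|^2].

    Nothing is known about the boundary of the velocity domain, so the integration
    by parts is first carried out for [psi_e(f) |v|^2], where [psi_e] is a C^1
    function vanishing on [-e, e]: extended by zero it is C^1 with compact
    support, because [f] vanishes on the boundary and at infinity. Dominated
    convergence as [e -> 0] gives the formula up to the integral of [|v|^2 df/dv_i]
    over [{f = 0}], which is zero: on each line in the direction [i], the zeros of
    [f] at which [df/dv_i <> 0] are isolated, hence countable. *)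

Require Import Defs.
From mathcomp Require Import all_boot all_order all_algebra.
From mathcomp Require Import all_classical all_reals all_analysis.
From mathcomp Require Import measurable_realfun ring lra.

Set Implicit Arguments.
Unset Strict Implicit.
Unset Printing Implicit Defensive.

Import Order.TTheory GRing.Theory Num.Theory.
Import numFieldNormedType.Exports.

Local Open Scope classical_set_scope.
Local Open Scope ring_scope.

(** * Integration on R^n along lines *)

Lemma measurable_line {R : realType} n (v : 'rV[R]_n) (i : 'I_n) :
  measurable_fun setT (fun t : measurableTypeR R => v + t *: unit_vec i).
Proof.
apply: measurable_fun_rV => j.
rewrite (_ : (fun x => _) = (fun x : R => v ord0 j + x * unit_vec i ord0 j)); last first.
  by apply/funext => x; rewrite !mxE.
apply: measurable_funD => //; apply: measurable_funM => //.
Qed.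

Lemma cons_rV_line0 {R : realType} n (t : R) (w : 'rV[R]_n) :
  cons_rV (t, w) = cons_rV (0, w) + t *: unit_vec ord0.
Proof.
apply/rowP => j; rewrite !mxE /=.
case: (@split_ordP 1 n j) => k jk; rewrite ?mxE.
  by rewrite add0r jk ord1 (_ : _ == _ = true) ?mulr1.
by rewrite jk (_ : _ == _ = false) ?mulr0 ?addr0.
Qed.

Lemma cons_rV_lineS {R : realType} n (r t : R) (w : 'rV[R]_n) (i : 'I_n) :
  cons_rV (r, w + t *: unit_vec i) = cons_rV (r, w) + t *: unit_vec (lift ord0 i).
Proof.
apply/rowP => j; rewrite !mxE /=.
case: (@split_ordP 1 n j) => k jk; rewrite ?mxE.
  by rewrite jk ord1 (_ : _ == _ = false) ?mulr0 ?addr0.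
by rewrite jk; congr (_ + _ * (_)%:R).
Qed.

(** [lebesgue_rV n.+1] is by construction an image measure, so this is the change of variables along
    [cons_rV]. *)
Lemma integral_cons_rV {R : realType} n (f : 'rV[R]_n.+1 -> \bar R) :
  (lebesgue_rV n.+1).-integrable setT f ->
  (@lebesgue_measure R \x lebesgue_rV n)%E.-integrable setT (f \o @cons_rV R n) /\
  (\int[lebesgue_rV n.+1]_v f v =
   \int[@lebesgue_measure R \x lebesgue_rV n]_p f (cons_rV p))%E.
Proof.
move=> fi.
have mf := measurable_int _ fi.
have fi' : (@lebesgue_measure R \x lebesgue_rV n)%E.-integrable setT (f \o @cons_rV R n).
  apply/integrableP; split.
    by apply: measurableT_comp => //; exact: measurable_cons_rV.
  case/integrableP : fi => _.
  have := @ge0_integral_pushforward _ _ _ _ R _ (@measurable_cons_rV R n)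
    (@lebesgue_measure R \x lebesgue_rV n)%E setT (fun x => `|f x|%E).
  rewrite /= /lebesgue_cons preimage_setT => -> //.
  exact: measurableT_comp.
split=> //=.
by rewrite /lebesgue_cons (integral_pushforward (@measurable_cons_rV R n)).
Qed.

(** Fubini, by induction on the dimension. When [i] is the first coordinate, the line integral is
    the inner one; otherwise the inner integral runs over the remaining coordinates, and the
    induction hypothesis applies to almost every slice. *)
Lemma integral_line0 {R : realType} n (i : 'I_n) (f : 'rV[R]_n -> \bar R) :
  (lebesgue_rV n).-integrable setT f ->
  (forall v, (\int[@lebesgue_measure R]_t f (v + t *: unit_vec i)%R = 0)%E) ->
  (\int[lebesgue_rV n]_v f v = 0)%E.
Proof.
elim: n i f => [[]//|n IH] i f fi f0.
have [fi' ->] := integral_cons_rV fi.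
case: (unliftP ord0 i) f0 => [j|] -> f0.
  rewrite -[LHS](integral12_prod_meas1 fi') /fubini_F /=.
  rewrite (@ae_eq_integral _ _ _ _ setT (cst 0%E)) ?integral0//.
    exact: measurable_fubini_F fi'.
  apply: filterS (ae_integrable1 fi') => t ft _.
  apply: (IH j) => // v /=.
  by under eq_integral do rewrite cons_rV_lineS; exact: f0.
rewrite -[LHS](integral21_prod_meas1 fi') /fubini_G /=.
rewrite integral0_eq// => w _.
by under eq_integral do rewrite cons_rV_line0; exact: f0.
Qed.

(** The sigma-algebra is generated by the coordinates, so openness has to be reduced to them: an
    open set is the countable union of the cubes with rational centre and radius 1/(k+1) that it
    contains. *)
Lemma open_measurable_rV {R : realType} n (A : set 'rV[R]_n) :
  open A -> measurable A.
Proof.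
move=> oA.
pose I_ (qk : 'rV[rat]_n * nat) (i : 'I_n) : interval R :=
  `](ratr (qk.1 ord0 i) - qk.2.+1%:R^-1), (ratr (qk.1 ord0 i) + qk.2.+1%:R^-1)[.
pose B qk : set 'rV[R]_n := [set x | forall i, x ord0 i \in I_ qk i].
have mB qk : measurable (B qk).
  rewrite (_ : B qk = \bigcap_(i in [set: 'I_n])
    ((fun x : 'rV[R]_n => x ord0 i : measurableTypeR R) @^-1` [set` I_ qk i])); last first.
    by apply/seteqP; split=> [x Bx i _|x Bx i]; [exact: Bx|exact: Bx i I].
  apply: fin_bigcap_measurable => // i _; rewrite -[X in measurable X]setTI.
  exact: measurable_coord.
suff -> : A = \bigcup_qk (if `[< B qk `<=` A >] then B qk else set0).
  apply: countable_bigcupT_measurable => // qk.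
  by case: ifP.
apply/seteqP; split=> [x Ax|x [qk _]]; last by case: asboolP => [BA /BA|].
have /nbhs_ballP[e /= e0 eA] := open_nbhs_nbhs (conj oA Ax).
(* A cube of radius below e/2 that contains [x] lies in the ball of radius [e] around [x]. *)
have [k ke] : exists k : nat, k.+1%:R^-1 < e / 2.
  have [k _ /(_ k (leqnn _)) ke] := near_infty_natSinv_lt (PosNum (divr_gt0 e0 (ltr0Sn R 1))).
  by exists k.
have k0 : 0 < k.+1%:R^-1 :> R by rewrite invr_gt0.
set r := k.+1%:R^-1 in ke k0.
have [q xq] : {q : 'rV[rat]_n | forall i, `|x ord0 i - ratr (q ord0 i)| < r}.
  have H i : {q : rat | `|x ord0 i - ratr q| < r}.
    apply: cid; have : x ord0 i - r < x ord0 i + r by lra.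
    case/rat_in_itvoo => q; rewrite in_itv /= => /andP[qx xq]; exists q.
    by rewrite ltr_norml; apply/andP; split; lra.
  exists (\row_i (projT1 (H i))) => i; rewrite mxE.
  by case: (H i).
exists (q, k) => //; rewrite asboolT; rewrite /B /I_ /= -/r.
  move=> i /=; move: (xq i); rewrite in_itv /= ltr_norml => /andP[x1 x2].
  by apply/andP; split; lra.
move=> y By; apply: eA; split => // i j; rewrite (ord1 i).
have := By j; rewrite /I_ /= -/r in_itv/= => /andP[y1 y2].
have := xq j; rewrite ltr_norml => /andP[x1 x2].
by rewrite /ball /= ltr_norml; apply/andP; split; lra.
Qed.

Lemma continuous_measurable_rV {R : realType} n (f : 'rV[R]_n -> R) :
  continuous f -> measurable_fun setT f.
Proof.
move=> /continuousP cf; apply: (measurability _ (RGenOpens.measurableE R)).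
move=> _ [_ [a [b ->] <-]]; rewrite setTI.
by apply: open_measurable_rV; exact/cf/interval_open.
Qed.

Lemma box_compact {R : realType} n (a b : 'rV[R]_n) : compact (box a b).
Proof.
rewrite (_ : box a b = [set v | forall i, `[a ord0 i, b ord0 i]%classic (v ord0 i)]).
  apply: (@rV_compact R n (fun i => `[a ord0 i, b ord0 i]%classic)) => i.
  exact: segment_compact.
by apply/seteqP; split=> v vab i; have := vab i; rewrite /= in_itv.
Qed.

(** A continuous function is bounded on the compact box, which has finite measure. *)
Lemma continuous_box_integrable {R : realType} n (a b : 'rV[R]_n) (f : 'rV[R]_n -> R) :
  (forall i, a ord0 i <= b ord0 i) -> continuous f ->
  (lebesgue_rV n).-integrable (box a b) (EFin \o f).
Proof.
move=> ab cf; apply: measurable_bounded_integrable.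
- exact: measurable_box.
- by rewrite [X in (X < _)%E](lebesgue_rV_box ab) ltry.
- by apply: measurable_funTS; exact: continuous_measurable_rV.
- have /compact_bounded[M [Mr Mf]] : compact (f @` box a b).
    by apply: continuous_compact; [exact: continuous_subspaceT|exact: box_compact].
  by exists M; split => // x /Mf fM y /= aby; apply: fM; exists y.
Qed.

Lemma line_continuous {R : realType} n (v : 'rV[R]_n) (i : 'I_n) :
  continuous (fun t : R => v + t *: unit_vec i).
Proof.
move=> t; apply: cvgD; first exact: cvg_cst.
by apply: cvgZr_tmp; exact: cvg_id.
Qed.

Lemma is_derive_line {R : realType} n (F : 'rV[R]_n -> R) (i : 'I_n) (v : 'rV[R]_n)
    (t dF : R) :
  is_derive (v + t *: unit_vec i) (unit_vec i) F dF ->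
  is_derive t 1 (fun s => F (v + s *: unit_vec i)) dF.
Proof.
set w := v + t *: unit_vec i.
have E : (fun h : R => h^-1 *: (((fun s => F (v + s *: unit_vec i)) \o shift t) (h *: 1) - F w))
    = (fun h => h^-1 *: ((F \o shift w) (h *: unit_vec i) - F w)).
  by apply/funext => h /=; rewrite [_%:A]mulr1 scalerDl addrCA.
by case=> dF1 dF2; apply: DeriveDef; rewrite /derivable /derive E.
Qed.

(** On each line in direction [i], the fundamental theorem of calculus gives the difference of [F]
    between opposite faces. The last hypothesis makes it zero; it covers both periodicity and
    vanishing on the faces. *)
Lemma integral_box_derive {R : realType} n (i : 'I_n) (a b : 'rV[R]_n)
    (F dF : 'rV[R]_n -> R) :
  (forall j, a ord0 j < b ord0 j) ->
  (forall v, is_derive v (unit_vec i) F (dF v)) -> continuous dF ->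
  (forall v, box a b v -> v ord0 i = a ord0 i ->
     F (v + (b ord0 i - a ord0 i) *: unit_vec i) = F v) ->
  (\int[lebesgue_rV n]_(v in box a b) (dF v)%:E = 0)%E.
Proof.
move=> ab FdF cdF Fab; rewrite integral_mkcond.
apply: (@integral_line0 R n i) => [|v].
  apply/(integrable_mkcond _ (measurable_box a b)).1.
  by apply: continuous_box_integrable => // j; exact: ltW.
have coord t : (v + t *: unit_vec i) ord0 i = v ord0 i + t.
  by rewrite !mxE !eqxx mulr1.
have coordN t j : j != i -> (v + t *: unit_vec i) ord0 j = v ord0 j.
  by move=> ji; rewrite !mxE (negbTE ji) andbF mulr0 addr0.
(* If another coordinate is out of range, the whole line misses the box. *)
have [vab|vab] := pselect (forall j, j != i -> a ord0 j <= v ord0 j <= b ord0 j); last first.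
  apply: integral0_eq => t _; rewrite patchE memNset// => H; apply: vab => j ji.
  by have := H j; rewrite coordN.
pose a' := a ord0 i - v ord0 i; pose b' := b ord0 i - v ord0 i.
have a'b' : a' < b' by rewrite ltrD2r.
have boxE t : box a b (v + t *: unit_vec i) <-> t \in `[a', b'].
  rewrite in_itv /= /a' /b' !(lerBlDl, lerBrDl); split => [/(_ i)|tab j]; first by rewrite coord.
  by have [->|ji] := eqVneq j i; [rewrite coord|rewrite coordN// vab].
transitivity (\int[@lebesgue_measure R]_(t in `[a', b']) (dF (v + t *: unit_vec i)%R)%:E)%E.
  rewrite [RHS]integral_mkcond; apply: eq_integral => t _; rewrite !patchE.
  by congr (if _ then _ else _); apply/idP/idP; rewrite !inE => /boxE.
have G (t : R) : is_derive t 1 (fun s : R => F (v + s *: unit_vec i)) (dF (v + t *: unit_vec i)).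
  exact: is_derive_line.
have cG : continuous (fun s : R => F (v + s *: unit_vec i)).
  move=> t; apply: differentiable_continuous; apply/derivable1_diffP.
  by case: (G t).
rewrite (continuous_FTC2 (F := fun s : R => F (v + s *: unit_vec i)))//.
- rewrite (_ : v + b' *: unit_vec i =
      (v + a' *: unit_vec i) + (b ord0 i - a ord0 i) *: unit_vec i).
    rewrite Fab ?subee//; last by rewrite coord /a' addrC subrK.
    by apply/boxE; rewrite in_itv /= lexx ltW.
  by rewrite -addrA -scalerDl /a' /b'; congr (_ + _ *: _); lra.
- apply: continuous_subspaceT => t.
  by apply: continuous_comp; [exact: line_continuous|exact: cdF].
- split; first by move=> t _; case: (G t).
  + exact: cvg_at_right_filter (cG _).
  + exact: cvg_at_left_filter (cG _).
- by move=> t _; rewrite derive1E; case: (G t).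
Qed.

(** * A C^1 truncation near zero *)

(** The hypothesis bounds the error of the difference quotient by |h|. *)
Lemma is_derive_quadratic {R : realType} (V : normedModType R) (f : V -> R) (x u : V) (l : R) :
  (forall h : R, `|f (h *: u + x) - f x - h * l| <= h ^+ 2) -> is_derive x u f l.
Proof.
move=> H.
have C : h^-1 *: (f (h *: u + x) - f x) @[h --> 0^'] --> l.
  apply/cvgrPdist_le => e e0; near=> h.
  have h0 : h != 0 by near: h; exact: nbhs_dnbhs_neq.
  rewrite (_ : _ - _ = - (h^-1 * (f (h *: u + x) - f x - h * l))); last first.
    by rewrite -[_ *: _]/(_ * _); field.
  rewrite normrN normrM normfV ler_pdivrMl ?normr_gt0//.
  apply: (le_trans (H h)).
  rewrite -real_normK ?num_real// expr2 ler_pM2l ?normr_gt0//.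
  near: h; apply: dnbhs0_le; exact: e0.
apply: DeriveDef; last by apply/cvg_lim.
by apply/cvg_ex; exists l.
Unshelve. all: by end_near. Qed.

Lemma is_derive1P {R : realType} (V : normedModType R) (f : V -> R) (x u : V) (l : R) :
  is_derive x u f l <-> is_derive (0 : R) (1 : R) (fun h : R => f (h *: u + x)) l.
Proof.
have E : (fun h : R => h^-1 *: ((f \o shift x) (h *: u) - f x))
    = (fun h => h^-1 *: (((fun s : R => f (s *: u + x)) \o shift 0) (h *: (1 : R))
                          - f (0 *: u + x))).
  by apply/funext => h /=; rewrite [_%:A]mulr1 addr0 scale0r add0r.
by split => -[d1 d2]; apply: DeriveDef; move: d1 d2; rewrite /derivable /derive E.
Qed.

(** Only a directional derivative of [g] is given, so the chain rule is applied to the restriction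
    of [g] to a line. *)
Lemma is_derive_comp_real {R : realType} (V : normedModType R) (psi : R -> R) (g : V -> R)
    (x u : V) (dpsi dg : R) :
  is_derive (g x) 1 psi dpsi -> is_derive x u g dg ->
  is_derive x u (psi \o g) (dpsi * dg).
Proof.
move=> dpsix /is_derive1P dgx; apply/is_derive1P.
apply: (@is_derive1_comp _ psi (fun h : R => g (h *: u + x))).
by rewrite scale0r add0r.
Qed.

(* [psi_e(s) = s r^2] with [r = max(s^2 - e^2, 0) / (s^2 + e^2)]; the denominator
   is chosen so as not to vanish at [s = 0]. *)
Definition cutoff {R : realType} (e s : R) : R :=
  s * (Num.max (s ^+ 2 - e ^+ 2) 0 / (s ^+ 2 + e ^+ 2)) ^+ 2.

(** The product rule gives r^2 + 2 s r r'. For |s| > e, 1 - r = 2 e^2 / (s^2 + e^2), hence s r' = 2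
    (s^2 / (s^2 + e^2)) (1 - r); for |s| <= e, r = 0. In this form a bound independent of [e] can be
    read off. *)
Definition dcutoff {R : realType} (e s : R) : R :=
  let r := Num.max (s ^+ 2 - e ^+ 2) 0 / (s ^+ 2 + e ^+ 2) in
  r ^+ 2 + 4 * (s ^+ 2 / (s ^+ 2 + e ^+ 2)) * (r * (1 - r)).

Section cutoff.
Context {R : realType}.
Implicit Types e s : R.

(** Squaring removes the kink of the positive part at 0: in each sign case the remainder is at most
    h^2. This is why the ratio in [cutoff] is squared. *)
Lemma is_derive_sqr_max0 (y : R) :
  is_derive y 1 (fun y : R => Num.max y 0 ^+ 2) (2 * Num.max y 0).
Proof.
apply: is_derive_quadratic => h; rewrite [_%:A]mulr1.
rewrite ler_norml; apply/andP.
by have [] := leP y 0; have [] := leP (h + y) 0; split; nra.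
Qed.

Lemma cutoff_den e s : 0 < e -> 0 < s ^+ 2 + e ^+ 2.
Proof. by move=> e0; rewrite ltr_wpDl ?sqr_ge0// exprn_gt0. Qed.

Lemma cutoff_ratio e s : 0 < e ->
  0 <= Num.max (s ^+ 2 - e ^+ 2) 0 / (s ^+ 2 + e ^+ 2) <= 1.
Proof.
move=> e0; have D := cutoff_den s e0.
rewrite divr_ge0 ?le_max ?lexx ?orbT ?(ltW D)//= ler_pdivrMr// mul1r ge_max (ltW D) andbT.
by have := sqr_ge0 e; lra.
Qed.

Lemma is_derive_cutoff e s : 0 < e -> is_derive s 1 (cutoff e) (dcutoff e s).
Proof.
move=> e0; have D0 := cutoff_den s e0.
have D' : is_derive s 1 (fun s : R => s ^+ 2 - e ^+ 2) (2 * s).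
  apply: is_derive_quadratic => h; rewrite [_%:A]mulr1.
  by rewrite (_ : _ - _ - _ = h ^+ 2) ?ger0_norm ?sqr_ge0//; ring.
have D : is_derive s 1 (fun s : R => s ^+ 2 + e ^+ 2) (2 * s).
  apply: is_derive_quadratic => h; rewrite [_%:A]mulr1.
  by rewrite (_ : _ - _ - _ = h ^+ 2) ?ger0_norm ?sqr_ge0//; ring.
have M := @is_derive_comp_real _ _ (fun y : R => Num.max y 0 ^+ 2)
  (fun s : R => s ^+ 2 - e ^+ 2) _ _ _ _ (is_derive_sqr_max0 (s ^+ 2 - e ^+ 2)) D'.
have V : is_derive s 1 (fun s : R => (s ^+ 2 + e ^+ 2)^-1)
    (- (s ^+ 2 + e ^+ 2) ^- 2 * (2 * s)).
  case: D => D1 D2; apply: DeriveDef.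
    by apply: derivableV => //; rewrite gt_eqF.
  by rewrite deriveV ?D2// gt_eqF.
have := is_deriveM (is_deriveM (is_derive_id s 1) M) (is_deriveX 2 V).
rewrite [X in is_derive _ _ X _](_ : _ = cutoff e); last first.
  apply/funext => t; rewrite /cutoff /= !mulrfctE exprfctE /= expr_div_n exprVn.
  by rewrite expr2 !mulrA.
move=> H; apply: (@is_derive_eq _ _ _ _ _ _ _ _ H).
rewrite /dcutoff /= !mulrfctE !exprfctE /GRing.scale /=.
(* Both sides agree as rational functions of [m], so the maximum needs no case distinction. *)
set m := Num.max _ _.
by field; rewrite gt_eqF.
Qed.

(** With q = s^2 / (s^2 + e^2) and [r] both in [0, 1], the value is r^2 + 4 q r (1 - r), at most 1 +
    1. The bound is uniform in [e], as dominated convergence requires. *)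
Lemma dcutoff_bound e s : 0 < e -> `|dcutoff e s| <= 2.
Proof.
move=> e0; have := cutoff_ratio s e0; rewrite /dcutoff /=.
set r := Num.max _ _ / _ => /andP[r0 r1].
have D := cutoff_den s e0.
have : 0 <= s ^+ 2 / (s ^+ 2 + e ^+ 2) <= 1.
  rewrite divr_ge0 ?sqr_ge0 ?(ltW D)//= ler_pdivrMr// mul1r lerDl.
  exact: sqr_ge0.
set q := s ^+ 2 / _ => /andP[q0 q1].
have p0 : 0 <= r * (1 - r) by rewrite mulr_ge0// subr_ge0.
have p1 : 4 * (r * (1 - r)) <= 1 by have := sqr_ge0 (2 * r - 1); nra.
have r2 : r ^+ 2 <= 1 by rewrite expr_le1.
have qp0 : 0 <= q * (r * (1 - r)) by exact: mulr_ge0.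
have qp1 : q * (r * (1 - r)) <= r * (1 - r) by exact: ler_piMl.
rewrite -mulrA ger0_norm; first by lra.
by rewrite addr_ge0 ?sqr_ge0// mulr_ge0.
Qed.

Lemma cutoff_bound e s : 0 < e -> `|cutoff e s| <= `|s|.
Proof.
move=> e0; rewrite /cutoff normrM ler_piMr// ger0_norm ?sqr_ge0//.
by have /andP[r0 r1] := cutoff_ratio s e0; rewrite expr_le1.
Qed.

Lemma cutoff0 e s : 0 < e -> `|s| < e -> cutoff e s = 0 /\ dcutoff e s = 0.
Proof.
move=> e0 se; have : s ^+ 2 - e ^+ 2 <= 0.
  rewrite subr_le0 -real_normK ?num_real// ler_pXn2r ?nnegrE// ?ltW//.
by rewrite /cutoff /dcutoff /= => /max_idPr ->; split; ring.
Qed.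

Lemma continuous_cutoff e : 0 < e -> continuous (cutoff e).
Proof.
move=> e0 s; apply: differentiable_continuous; apply/derivable1_diffP.
by case: (is_derive_cutoff s e0).
Qed.

Lemma cvg_sqr T (F : set_system T) {FF : Filter F} (u_ : T -> R) (u : R) :
  u_ @ F --> u -> (fun x => u_ x ^+ 2) @ F --> u ^+ 2.
Proof. by move=> cu; rewrite [X in X @ _](_ : _ = u_ \* u_)//; apply: cvgM. Qed.

(** Letting both [s] and [e] vary covers two limits: continuity in [s] at fixed [e], and [e] tending
    to 0 at fixed nonzero [s]. *)
Lemma cvg_cutoff_ratio T (F : set_system T) {FF : Filter F} (s_ e_ : T -> R) e s :
  s ^+ 2 + e ^+ 2 != 0 ->
  s_ @ F --> s -> e_ @ F --> e ->
  (fun x => Num.max (s_ x ^+ 2 - e_ x ^+ 2) 0 / (s_ x ^+ 2 + e_ x ^+ 2)) @ F -->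
  Num.max (s ^+ 2 - e ^+ 2) 0 / (s ^+ 2 + e ^+ 2).
Proof.
move=> D0 cs ce.
apply: cvgM; last by apply: cvgV => //; apply: cvgD; exact: cvg_sqr.
have maxE (y : R) : Num.max y 0 = (y + `|y|) / 2.
  by have [y0|y0] := leP y 0; [rewrite ler0_norm//; field|rewrite gtr0_norm//; field].
rewrite maxE; under eq_fun do rewrite maxE.
apply: cvgMl; apply: cvgD; last apply: cvg_norm; by apply: cvgB; exact: cvg_sqr.
Qed.

Lemma cvg_dcutoff T (F : set_system T) {FF : Filter F} (s_ e_ : T -> R) e s :
  s ^+ 2 + e ^+ 2 != 0 ->
  s_ @ F --> s -> e_ @ F --> e ->
  (fun x => dcutoff (e_ x) (s_ x)) @ F --> dcutoff e s.
Proof.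
move=> D0 cs ce; have cr := @cvg_cutoff_ratio T F FF s_ e_ e s D0 cs ce.
rewrite /dcutoff /=.
apply: cvgD; first exact: (cvg_sqr cr).
apply: cvgM; last by apply: cvgM => //; apply: cvgB => //; exact: cvg_cst.
apply: cvgMr; apply: cvgM; first exact: (cvg_sqr cs).
by apply: cvgV => //; apply: cvgD; exact: cvg_sqr.
Qed.

Lemma continuous_dcutoff e : 0 < e -> continuous (dcutoff e).
Proof.
move=> e0 s; have D0 : s ^+ 2 + e ^+ 2 != 0 by rewrite gt_eqF// cutoff_den.
exact: (@cvg_dcutoff _ (nbhs s) _ id (cst e) e s D0 (fun=> id) (@cvg_cst _ e _ (nbhs s) _)).
Qed.

Lemma cvg_cutoff0 s : cutoff n.+1%:R^-1 s @[n --> \oo] --> s.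
Proof.
have [->|s0] := eqVneq s 0.
  by under eq_fun do rewrite /cutoff mul0r; exact: cvg_cst.
have D0 : s ^+ 2 + 0 ^+ 2 != 0 by rewrite expr0n addr0 expf_neq0.
have r1 : Num.max (s ^+ 2 - 0 ^+ 2) 0 / (s ^+ 2 + 0 ^+ 2) = 1.
  by rewrite expr0n subr0 addr0 (max_idPl _) ?sqr_ge0// divff// expf_neq0.
have FF : Filter (\oo : set_system nat) by typeclasses eauto.
have := @cvg_cutoff_ratio _ _ FF (cst s) harmonic 0 s D0 (@cvg_cst _ s _ _ FF) cvg_harmonic.
rewrite r1 => cr.
rewrite -[X in _ --> X]mulr1; apply: cvgMr.
by have := @cvg_sqr _ _ FF _ _ cr; rewrite expr1n.
Qed.

(** At s = 0 the derivative is 0 for every [e], so the limit is the indicator of s != 0 and not the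
    constant 1: the zero set of the density will call for a separate argument. *)
Lemma cvg_dcutoff0 s :
  dcutoff n.+1%:R^-1 s @[n --> \oo] --> ((s != 0)%:R : R).
Proof.
have [->|s0] := eqVneq s 0.
  have E n : dcutoff n.+1%:R^-1 0 = 0 :> R.
    by have [] := @cutoff0 n.+1%:R^-1 0; rewrite ?normr0 ?invr_gt0.
  by under eq_fun do rewrite E; exact: cvg_cst.
have D0 : s ^+ 2 + 0 ^+ 2 != 0 by rewrite expr0n addr0 expf_neq0.
have FF : Filter (\oo : set_system nat) by typeclasses eauto.
have := @cvg_dcutoff _ _ FF (cst s) harmonic 0 s D0 (@cvg_cst _ s _ _ FF) cvg_harmonic.
rewrite [dcutoff 0 s](_ : _ = 1)// /dcutoff /=.
rewrite expr0n subr0 addr0 (max_idPl _) ?sqr_ge0// divff ?expf_neq0//.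
by rewrite subrr !mulr0 addr0 expr1n.
Qed.

End cutoff.

(** * Integration by parts in velocity *)

(** A zero with nonzero derivative is isolated, hence the only zero in some interval with rational
    endpoints, and there are countably many such intervals. *)
Lemma countable_simple_zeros {R : realType} (phi : R -> R) :
  countable [set t | [/\ phi t = 0, derivable phi t 1 & 'D_1 phi t != 0]].
Proof.
pose Z (pq : rat * rat) : set R := [set t |
  (ratr pq.1 < t < ratr pq.2) /\ forall s, ratr pq.1 < s < ratr pq.2 -> phi s = 0 -> s = t].
pose Z0 pq := Z pq `&` [set t | phi t = 0].
apply: (@sub_countable _ _ _ (\bigcup_pq (Z0 pq))); last first.
  apply: bigcup_countable => [|pq _]; first exact: countableP.
  (* [Z0 pq] has at most one point, which [get] selects if there is one. *)
  apply: (@sub_countable _ _ _ (set1 (get (Z0 pq)))); last exact: countable1.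
  apply: subset_card_le => t Zt.
  have [[gZ1 gZ2] gZ3] : Z0 pq (get (Z0 pq)) by apply: getI; exact: Zt.
  case: Zt => -[t1 t2] t3 /=.
  by apply: gZ2.
apply: subset_card_le => t [phit dphi Dphi].
(* The difference quotients have a nonzero limit, so they are nonzero for small [h]; a second zero
   close to [t] would make one of them vanish. *)
have : \forall h \near 0^', h^-1 *: (phi (h *: (1 : R) + t) - phi t) != 0.
  have C : h^-1 *: (phi (h *: (1 : R) + t) - phi t) @[h --> 0^'] --> 'D_1 phi t by exact: dphi.
  have O : open_nbhs ('D_1 phi t) [set x : R | x != 0] by split => //; exact: open_neq.
  exact: C _ (open_nbhs_nbhs O).
rewrite phit => /nbhs_ballP[r /= r0 rphi].
have [p] := @rat_in_itvoo _ (t - r) t (ltac:(by lra)).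
have [q] := @rat_in_itvoo _ t (t + r) (ltac:(by lra)).
rewrite !in_itv /= => /andP[tq qr] /andP[rp pt].
exists (p, q) => //; split => //=; split; first by rewrite pt tq.
move=> s /andP[ps sq] phis.
apply/eqP; apply/negPn/negP => st.
have := rphi (s - t); rewrite /ball /= sub0r normrN => H.
have := H (ltac:(by rewrite ltr_norml; apply/andP; split; lra)) (ltac:(by rewrite subr_eq0)).
by rewrite [_%:A]mulr1 subrK phis subr0 scaler0 eqxx.
Qed.

Lemma norm_coord_le {R : realType} n (v : 'rV[R]_n) i : `|v ord0 i| <= `|v|.
Proof.
rewrite [leRHS]/Num.norm /= mx_normrE.
by apply: (le_bigmax _ (fun ij : 'I_1 * 'I_n => `|v ij.1 ij.2|) (ord0, i)).
Qed.

Lemma is_derive_vdot {R : realType} d (v : 'rV[R]_d) (i : 'I_d) :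
  is_derive v (unit_vec i) (fun w => vdot w w) (2 * v ord0 i).
Proof.
apply: is_derive_quadratic => h.
rewrite (_ : _ - _ - _ = h ^+ 2) ?ger0_norm ?sqr_ge0//.
rewrite /vdot -sumrB (bigD1 i)//= big1 ?addr0 => [|j ji].
  by rewrite !mxE !eqxx /=; ring.
by rewrite !mxE (negbTE ji) andbF /=; ring.
Qed.

Lemma continuous_vdot {R : realType} d : continuous (fun w : 'rV[R]_d => vdot w w).
Proof.
rewrite /vdot; elim: (index_enum _) => [|i s IH].
  rewrite (_ : (fun _ => _) = cst 0); first exact: cst_continuous.
  by apply/funext => w; rewrite big_nil.
rewrite (_ : (fun _ => _) = (fun w : 'rV[R]_d => w ord0 i * w ord0 i) \+
    (fun w => \sum_(j <- s) w ord0 j * w ord0 j)); last first.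
  by apply/funext => w; rewrite big_cons.
move=> v; have c : (fun w : 'rV[R]_d => w ord0 i) @ v --> v ord0 i.
  exact: (@coord_continuous R 1 d ord0 i v).
exact: (continuousD (continuousM c c) (IH v)).
Qed.

Lemma near_eq_continuous {T U : topologicalType} (f h : T -> U) (v : T) :
  (\forall w \near v, f w = h w) -> {for v, continuous f} -> {for v, continuous h}.
Proof.
move=> fh cf; have fhv : f v = h v := nbhs_singleton fh.
rewrite /prop_for /continuous_at -fhv; apply: cvg_trans cf.
by apply: near_eq_cvg; apply: filterS fh => w ->.
Qed.

(** * Integration by parts against |v|^2 for one function of the velocity *)

Section velocity_by_parts.
Context {R : realType} {d : nat} (Omv : set 'rV[R]_d) (i : 'I_d) (g : 'rV[R]_d -> R).
Hypothesis oOmv : open Omv.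
Hypothesis cg : {within closure Omv, continuous g}.
Hypothesis dg : forall v, Omv v -> derivable g v (unit_vec i).
Hypothesis cdg : forall v, Omv v -> {for v, continuous (partial i g)}.
Hypothesis vg : vanishing Omv g.

(** Extension by zero, since nothing is known of [g] outside the closure of [Omv]. *)
Let g0 v : R := if v \in Omv then g v else 0.

Let g0E v : Omv v -> g0 v = g v.
Proof. by move=> Ov; rewrite /g0 mem_set. Qed.

Let g0N v : ~ Omv v -> g0 v = 0.
Proof. by move=> Ov; rewrite /g0 memNset. Qed.

Let near_Omv v : Omv v -> \forall w \near v, Omv w.
Proof. by move=> Ov; apply: open_nbhs_nbhs. Qed.

Let g_continuous_at v : Omv v -> {for v, continuous g}.
Proof.
move=> Ov.
have : {within Omv, continuous g} by apply: continuous_subspaceW cg; exact: subset_closure.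
by rewrite continuous_open_subspace//; apply; rewrite inE.
Qed.

(** Three cases: inside the open set; at a boundary point, where [g] vanishes and is continuous
    within the closure; off the closure, where [g0] is locally zero. *)
Let cg0 : continuous g0.
Proof.
move=> v; have [Ov|Ov] := pselect (Omv v).
  apply: near_eq_continuous (g_continuous_at Ov).
  by apply: filterS (near_Omv Ov) => w Ow; rewrite g0E.
rewrite /continuous_at g0N//; apply/(@cvgrPdist_lt R R _ (nbhs v) _ g0 0) => e e0.
have [cOv|cOv] := pselect (closure Omv v).
  have gv : g v = 0 by apply: vg.1.
  have cgv : g @ within (closure Omv) (nbhs v) --> g v by move/subspace_continuousP : cg; exact.
  have H := (@cvgrPdist_lt _ _ _ _ _ _ _).1 cgv e e0.
  have : \forall w \near v, closure Omv w -> `|g v - g w| < e by exact: H.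
  apply: filterS => w; rewrite gv => gw.
  have [Ow|Ow] := pselect (Omv w); last by rewrite g0N// subr0 normr0.
  by rewrite g0E//; apply: gw; exact: subset_closure.
have : nbhs v (~` closure Omv).
  by apply: open_nbhs_nbhs; split => //; apply: closed_openC; exact: closed_closure.
apply: filterS => w cOw; rewrite g0N ?subr0 ?normr0//.
by move=> Ow; apply: cOw; exact: subset_closure.
Qed.

Let near_small v e : 0 < e -> ~ Omv v -> \forall w \near v, `|g0 w| < e.
Proof.
move=> e0 Ov; have /cvgrPdist_lt := @cg0 v; rewrite g0N// => /(_ e e0).
by apply: filterS => w; rewrite sub0r normrN.
Qed.

Let F e v := cutoff e (g0 v) * vdot v v.

Let dF e v : R := if v \in Omv then
  dcutoff e (g v) * (partial i g v * vdot v v) + 2 * (cutoff e (g v) * v ord0 i) else 0.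

(** At a point outside [Omv], boundary included, |g0| is smaller than [e] nearby, so the cutoff
    makes [F e] locally zero. *)
Let is_derive_F e v : 0 < e -> is_derive v (unit_vec i) (F e) (dF e v).
Proof.
move=> e0; have [Ov|Ov] := pselect (Omv v).
  rewrite /dF mem_set//.
  have D1 := derivableP (dg Ov).
  have D2 := is_deriveM (is_derive_comp_real (is_derive_cutoff (g v) e0) D1)
    (is_derive_vdot v i).
  apply: (@near_eq_is_derive _ _ _ ((cutoff e \o g) * (fun w => vdot w w))).
    by apply: filterS (near_Omv Ov) => w Ow; rewrite /F g0E.
  apply: is_derive_eq D2 _.
  by rewrite /partial /= /GRing.scale /=; ring.
rewrite /dF memNset//.
apply: (@near_eq_is_derive _ _ _ (cst (0 : R))).
apply: filterS (near_small e0 Ov) => w Ow.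
by rewrite /F (cutoff0 e0 Ow).1 mul0r.
Qed.

Let continuous_dF e : 0 < e -> continuous (dF e).
Proof.
move=> e0 v; have [Ov|Ov] := pselect (Omv v); last first.
  apply: (@near_eq_continuous _ _ (cst 0)); last exact: cst_continuous.
  apply: filterS (near_small e0 Ov) => w gw.
  rewrite /dF; case: ifPn => // /set_mem Ow.
  have [|-> ->] := @cutoff0 R e (g w) e0; first by rewrite -g0E.
  by rewrite !mul0r mulr0 addr0.
pose K w := dcutoff e (g w) * (partial i g w * vdot w w) + 2 * (cutoff e (g w) * w ord0 i).
have cK : {for v, continuous K}.
  have c1 : {for v, continuous (fun w => dcutoff e (g w))}.
    by apply: continuous_comp; [exact: g_continuous_at|exact: continuous_dcutoff].
  have c2 : {for v, continuous (fun w => cutoff e (g w))}.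
    by apply: continuous_comp; [exact: g_continuous_at|exact: continuous_cutoff].
  have c3 := @coord_continuous R 1 d ord0 i v.
  apply: continuousD; last first.
    by apply: continuousM; [exact: cst_continuous|exact: continuousM c2 c3].
  apply: continuousM => //; apply: continuousM; first exact: cdg.
  exact: continuous_vdot.
have EK w : Omv w -> dF e w = K w by move=> Ow; rewrite /dF mem_set.
apply: near_eq_continuous cK.
by apply: filterS (near_Omv Ov) => w Ow; rewrite EK.
Qed.

(** [F e] vanishes for large |v|, so its derivative integrates to zero over a cube whose faces lie
    where [F e] vanishes. *)
Let integral_dF e : 0 < e ->
  (\int[lebesgue_rV d]_(v in Omv) (dcutoff e (g v) * (partial i g v * vdot v v) +
     2 * (cutoff e (g v) * v ord0 i))%:E = 0)%E.
Proof.
move=> e0.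
have [M M0 gM] : exists2 M, 0 < M & forall v, M < `|v| -> `|g0 v| < e.
  (* The maximum with 1 keeps the radius positive whatever bound [vanishing] supplies. *)
  have [M gM] := vg.2 e e0; exists (Num.max M 1); first by rewrite lt_max ltr01 orbT.
  move=> v; rewrite gt_max => /andP[Mv _].
  have [Ov|Ov] := pselect (Omv v); first by rewrite g0E// gM.
  by rewrite g0N// normr0.
have F0 v : M < `|v| -> F e v = 0.
  by move=> Mv; rewrite /F (cutoff0 e0 (gM v Mv)).1 mul0r.
have dF0 v : M < `|v| -> dF e v = 0.
  move=> Mv; rewrite /dF; case: ifPn => // /set_mem Ov.
  have [|-> ->] := @cutoff0 R e (g v) e0; first by rewrite -g0E// gM.
  by rewrite !mul0r mulr0 addr0.
(* Half-side M + 1 puts the faces strictly beyond |v| = M. *)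
pose a : 'rV[R]_d := const_mx (- (M + 1)); pose b : 'rV[R]_d := const_mx (M + 1).
transitivity (\int[lebesgue_rV d]_(v in box a b) (dF e v)%:E)%E; last first.
  apply: (@integral_box_derive R d i a b (F e)).
  - by move=> j; rewrite !mxE; lra.
  - by move=> v; exact: is_derive_F.
  - exact: continuous_dF.
  - move=> v _ vi; rewrite !F0//.
      by apply: lt_le_trans (norm_coord_le v i); rewrite vi mxE normrN gtr0_norm; lra.
    apply: lt_le_trans (norm_coord_le _ i).
    by rewrite !mxE !eqxx vi mxE /= ger0_norm; lra.
rewrite integral_mkcond [RHS]integral_mkcond; apply: eq_integral => v _.
transitivity ((dF e v)%:E); first by rewrite patchE /dF; case: ifP.
rewrite patchE; case: ifPn => // /negP; rewrite inE => vab.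
rewrite dF0//; apply: contra_notP vab => /negP; rewrite -leNgt => vM j.
rewrite !mxE -ler_norml (le_trans (norm_coord_le v j))// (le_trans vM)//.
by lra.
Qed.

Hypothesis ip : (lebesgue_rV d).-integrable Omv (fun v => (partial i g v * vdot v v)%:E).
Hypothesis iq : (lebesgue_rV d).-integrable Omv (fun v => (g v * v ord0 i)%:E).

Let mOmv : measurable Omv. Proof. exact: open_measurable_rV. Qed.

Let p v := partial i g v * vdot v v.

Let mg : measurable_fun Omv g.
Proof.
have m0 : measurable_fun Omv g0.
  by apply: measurable_funTS; exact: continuous_measurable_rV.
by apply: eq_measurable_fun m0 => v /set_mem; exact: g0E.
Qed.

Let mp : measurable_fun Omv p.
Proof. by apply/measurable_EFinP; exact: measurable_int ip. Qed.

Let e_ n : R := n.+1%:R^-1.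

Let e_gt0 n : 0 < e_ n. Proof. by rewrite invr_gt0. Qed.

Let mdp n : measurable_fun Omv (fun v => dcutoff (e_ n) (g v) * p v).
Proof.
apply: measurable_funM => //; apply: (measurableT_comp _ mg).
by apply: continuous_measurable_fun; exact: continuous_dcutoff.
Qed.

Let mdq n : measurable_fun Omv (fun v => 2 * (cutoff (e_ n) (g v) * v ord0 i)).
Proof.
apply: measurable_funM; first exact: measurable_cst.
apply: measurable_funM; last by apply: measurable_funTS; exact: measurable_coord.
by apply: (measurableT_comp _ mg); apply: continuous_measurable_fun; exact: continuous_cutoff.
Qed.

Let mnz : measurable_fun Omv (fun v => (g v != 0)%:R * p v).
Proof.
apply: (@measurable_fun_cvg _ _ _ _ (fun n v => dcutoff (e_ n) (g v) * p v)) => // v _.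
by apply: cvgMl; exact: cvg_dcutoff0.
Qed.

(** Dominated convergence along e_n = 1/(n+1), with [G] as the bound. Where g = 0 the factor
    [dcutoff] tends to 0, so the limit retains the derivative only where g != 0. *)
Let integral_nz :
  (lebesgue_rV d).-integrable Omv (fun v => ((g v != 0)%:R * p v + 2 * (g v * v ord0 i))%:E) /\
  (\int[lebesgue_rV d]_(v in Omv) ((g v != 0)%:R * p v + 2 * (g v * v ord0 i))%:E = 0)%E.
Proof.
pose f_ n v := (dcutoff (e_ n) (g v) * p v + 2 * (cutoff (e_ n) (g v) * v ord0 i))%:E.
pose f v := ((g v != 0)%:R * p v + 2 * (g v * v ord0 i))%:E.
pose G v := (2%:E * `|(p v)%:E| + 2%:E * `|(g v * v ord0 i)%:E|)%E.
have [] := @dominated_convergence _ _ _ (lebesgue_rV d) Omv mOmv f_ f G.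
- by move=> n; apply/measurable_EFinP; apply: measurable_funD.
- apply/measurable_EFinP; apply: measurable_funD => //.
  apply: measurable_funM; first exact: measurable_cst.
  by apply/measurable_EFinP; exact: measurable_int iq.
- apply: aeW => v _; apply: cvg_EFin; first by near=> n.
  apply: cvgD; first by apply: cvgMl; exact: cvg_dcutoff0.
  by apply: cvgMr; apply: cvgMl; exact: cvg_cutoff0.
- apply: integrableD => //; apply: integrableZl => //; exact: integrable_abse.
- apply: aeW => v n _; rewrite /f_ /G /= -!EFinM -EFinD lee_fin.
  apply: (le_trans (ler_normD _ _)); rewrite lerD// normrM.
    by rewrite ler_wpM2r// dcutoff_bound.
  rewrite normrM [X in X * _]ger0_norm// ler_wpM2l// [leRHS]normrM ler_wpM2r//.
  exact: cutoff_bound.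
move=> fi _ fc; split => //.
have f0 : [sequence (\int[lebesgue_rV d]_(v in Omv) f_ n v)%E]_n = cst 0%E.
  by apply/funext => n; apply: integral_dF.
move: fc; rewrite f0 => /cvg_lim <-//.
by apply/cvg_lim => //; exact: cvg_cst.
Unshelve. all: by end_near. Qed.

(** On a line in direction [i], a nonzero integrand forces a zero of [g] with nonzero derivative.
    These are countably many, so every line integral vanishes, and [integral_line0] concludes. *)
Let integral_z :
  (lebesgue_rV d).-integrable Omv (fun v => ((g v == 0)%:R * p v)%:E) /\
  (\int[lebesgue_rV d]_(v in Omv) ((g v == 0)%:R * p v)%:E = 0)%E.
Proof.
have iz : (lebesgue_rV d).-integrable Omv (fun v => ((g v == 0)%:R * p v)%:E).
  apply: le_integrable ip => //.
    apply/measurable_EFinP.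
    rewrite (_ : (fun v => _) = p \- (fun v => (g v != 0)%:R * p v)).
      by apply: measurable_funB.
    by apply/funext => v /=; case: eqP => _ /=; ring.
  by move=> v _; rewrite lee_fin normrM; case: eqP => _; rewrite ?normr1 ?normr0 ?mul1r ?mul0r.
split=> //; rewrite integral_mkcond; have {}iz := (integrable_mkcond _ mOmv).1 iz.
apply: (integral_line0 (i := i) iz) => v.
pose phi (t : R) := g (v + t *: unit_vec i).
rewrite (@ae_eq_integral _ _ _ _ setT (cst 0%E)) ?integral0//.
  apply: (measurableT_comp (measurable_int _ iz)); exact: measurable_line.
exists [set t | [/\ phi t = 0, derivable phi t 1 & 'D_1 phi t != 0]].
split.
- by apply: countable_measurable => //; exact: countable_simple_zeros.
- exact/countable_lebesgue_measure0/countable_simple_zeros.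
move=> t /= /not_implyP[_]; rewrite patchE; case: ifPn => // /set_mem Ov.
have [gz|gz] := eqVneq (g (v + t *: unit_vec i)) 0; last by rewrite mul0r.
rewrite mul1r => pz.
have [D1 D2] := is_derive_line (derivableP (dg Ov)).
split => //; rewrite D2; apply: contra_not_neq pz => Dz.
by rewrite /p /partial Dz mul0r.
Qed.

Lemma integral_partial_vdot :
  (\int[lebesgue_rV d]_(v in Omv)
     (partial i g v * vdot v v + 2 * (g v * v ord0 i))%:E = 0)%E.
Proof.
have [inz nz0] := integral_nz; have [iz z0] := integral_z.
have := integralD mOmv inz iz; rewrite nz0 z0 adde0 => <-.
apply: eq_integral => v _; rewrite -EFinD; congr (_%:E).
by rewrite /p; case: eqP => _ /=; ring.
Qed.

End velocity_by_parts.

(** * Energy balance of the two schemes *)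

Section Rintegral_product.
Context {d1 d2 : measure_display} {T1 : measurableType d1} {T2 : measurableType d2} {R : realType}.
Variables (m1 : {sigma_finite_measure set T1 -> \bar R}).
Variables (m2 : {sigma_finite_measure set T2 -> \bar R}).
Variables (A : set T1) (B : set T2) (f : T1 * T2 -> R).
Hypotheses (mA : measurable A) (mB : measurable B).
Hypothesis fi : (m1 \x m2)%E.-integrable (A `*` B) (EFin \o f).

Let g := (EFin \o f) \_ (A `*` B).

Let gi : (m1 \x m2)%E.-integrable setT g.
Proof. by apply/(integrable_mkcond _ _).1 => //; exact: measurableX. Qed.

(** Inner integrals are real numbers here, [fine] sending an infinite value to 0. They are finite
    for almost every [x], so this conversion does not affect the outer integral. *)
Lemma Rintegral12_setX :
  \int[m1]_(x in A) \int[m2]_(y in B) f (x, y) = \int[(m1 \x m2)%E]_(p in A `*` B) f p.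
Proof.
rewrite /Rintegral [in RHS]integral_mkcond -/g -[in RHS](integral12_prod_meas1 gi).
congr fine; rewrite [LHS]integral_mkcond.
have FE x : fubini_F m2 g x = if x \in A then (\int[m2]_(y in B) (f (x, y))%:E)%E else 0%E.
  rewrite /fubini_F; case: ifPn => [/set_mem Ax|/negP Ax].
    rewrite [RHS]integral_mkcond; apply: eq_integral => y _; rewrite /g !patchE.
    by rewrite in_setX (mem_set Ax).
  apply: integral0_eq => y _; rewrite /g patchE in_setX.
  by case: (x \in A) Ax.
transitivity (\int[m1]_x (fine (fubini_F m2 g x))%:E)%E.
  by apply: eq_integral => x _; rewrite patchE FE; case: ifP.
have mF := measurable_fubini_F gi.
apply: ae_eq_integral => //.
  by apply/measurable_EFinP; exact: measurableT_comp.
apply: filterS (ae_integrable1 gi) => x gx _.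
by rewrite fineK// integrable_fin_num.
Qed.

Lemma Rintegral21_setX :
  \int[m2]_(y in B) \int[m1]_(x in A) f (x, y) = \int[(m1 \x m2)%E]_(p in A `*` B) f p.
Proof.
rewrite /Rintegral [in RHS]integral_mkcond -/g -[in RHS](integral21_prod_meas1 gi).
congr fine; rewrite [LHS]integral_mkcond.
have GE y : fubini_G m1 g y = if y \in B then (\int[m1]_(x in A) (f (x, y))%:E)%E else 0%E.
  rewrite /fubini_G; case: ifPn => [/set_mem By|/negP By].
    rewrite [RHS]integral_mkcond; apply: eq_integral => x _; rewrite /g !patchE.
    by rewrite in_setX (mem_set By) andbT.
  apply: integral0_eq => x _; rewrite /g patchE in_setX.
  by case: (y \in B) By => //; rewrite andbF.
transitivity (\int[m2]_y (fine (fubini_G m1 g y))%:E)%E.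
  by apply: eq_integral => y _; rewrite patchE GE; case: ifP.
have mG := measurable_fubini_G gi.
apply: ae_eq_integral => //.
  by apply/measurable_EFinP; exact: measurableT_comp.
apply: filterS (ae_integrable2 gi) => y gy _.
by rewrite fineK// integrable_fin_num.
Qed.

End Rintegral_product.

Lemma Rintegral_sum {d} {T : measurableType d} {R : realType}
    (mu : {measure set T -> \bar R}) (D : set T) n (h : 'I_n -> T -> R) :
  measurable D -> (forall i, mu.-integrable D (EFin \o h i)) ->
  \int[mu]_(x in D) (\sum_(i < n) h i x) = \sum_(i < n) \int[mu]_(x in D) h i x.
Proof.
move=> mD hi.
(* Integrability of the partial sums is carried along, since additivity of the integral asks for it
   at each step. *)
have [] : mu.-integrable D (EFin \o (fun x => \sum_(i < n) h i x)) /\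
  \int[mu]_(x in D) (\sum_(i < n) h i x) = \sum_(i < n) \int[mu]_(x in D) h i x; last by [].
elim: (index_enum _) => [|i s [IH1 IH2]].
  split; first by under eq_fun do rewrite big_nil; exact: integrable0.
  under eq_Rintegral do rewrite big_nil.
  by rewrite big_nil Rintegral_cst// mul0r.
have E : (fun x => \sum_(j <- i :: s) h j x) = (fun x => h i x + \sum_(j <- s) h j x).
  by apply/funext => x; rewrite big_cons.
rewrite E; split; first exact: (integrableD mD (hi i) IH1).
by rewrite big_cons -IH2 -RintegralD.
Qed.

Lemma pairl_continuous {T U : topologicalType} (v : U) :
  continuous (fun x : T => (x, v)).
Proof.
move=> x A [[B C] /= [nB nC] BCA].
by apply: filterS nB => y By; apply: BCA; split => //=; exact: nbhs_singleton.
Qed.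

Lemma pairr_continuous {T U : topologicalType} (x : T) :
  continuous (fun v : U => (x, v)).
Proof.
move=> v A [[B C] /= [nB nC] BCA].
by apply: filterS nC => y Cy; apply: BCA; split => //=; exact: nbhs_singleton.
Qed.

Lemma partial_mean {R : realType} {d : nat} (i : 'I_d) (f g : 'rV[R]_d -> R) x :
  derivable f x (unit_vec i) -> derivable g x (unit_vec i) ->
  partial i (fun y => (f y + g y) / 2) x = (partial i f x + partial i g x) / 2.
Proof.
move=> df dg; rewrite /partial.
have -> : (fun y => (f y + g y) / 2) = 2^-1 \*: (f + g).
  by apply/funext => y; rewrite mulrC.
by rewrite deriveZ ?deriveD//; [rewrite [LHS]mulrC|exact: derivableD].
Qed.

(** * Kinetic and total energy over one step of each scheme *)

Section schemes.
Context {R : realType} {d : nat} (a b : 'rV[R]_d) (Omv : set 'rV[R]_d).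
Hypothesis ab : forall i, a ord0 i < b ord0 i.
Hypothesis oOmv : open Omv.
Implicit Types s : state R d.

Local Notation mu := (@lebesgue_rV R d).

Let mOmv : measurable Omv. Proof. exact: open_measurable_rV. Qed.

Lemma continuous_partial_x s : admissible a b Omv s ->
  forall i v, Omv v -> continuous (partial i (density s ^~ v)).
Proof.
move=> adm i v Ov x.
apply: (@continuous_comp _ _ _ (fun y : 'rV[R]_d => (y, v))
  (fun p => partial i (density s ^~ p.2) p.1)); last exact: partial_x_continuous adm i x v Ov.
exact: pairl_continuous.
Qed.

Lemma continuous_partial_v s : admissible a b Omv s ->
  forall i x v, Omv v -> {for v, continuous (partial i (density s x))}.
Proof.
move=> adm i x v Ov.
apply: (@continuous_comp _ _ _ (fun w : 'rV[R]_d => (x, w))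
  (fun p => partial i (density s p.1) p.2)); last exact: partial_v_continuous adm i x v Ov.
exact: pairr_continuous.
Qed.

Lemma within_continuous_density s : admissible a b Omv s ->
  forall x, {within closure Omv, continuous (density s x)}.
Proof.
move=> adm x; apply/subspace_continuousP => v cOv.
have /subspace_continuousP/(_ (x, v) cOv) := density_continuous adm.
apply: cvg_trans => A /= nA.
have : within [set p : 'rV[R]_d * 'rV[R]_d | closure Omv p.2] (nbhs (x, v))
  ((fun p => density s p.1 p.2) @^-1` A) by exact: nA.
have c : (fun w : 'rV[R]_d => (x, w)) @ v --> (x, v).
  exact: pairr_continuous.
by move=> /c.
Qed.

(** Periodicity identifies the values on opposite faces of the box. *)
Lemma Rintegral_partial_x s : admissible a b Omv s ->
  forall i v, Omv v -> \int[mu]_(x in box a b) partial i (density s ^~ v) x = 0.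
Proof.
move=> adm i v Ov; rewrite /Rintegral.
suff -> : (\int[mu]_(x in box a b) (partial i (density s ^~ v) x)%:E = 0)%E by [].
apply: (@integral_box_derive _ _ i a b (density s ^~ v)) => //.
- by move=> x; apply: derivableP; exact: density_derivable_x adm _ _ _ Ov.
- exact: continuous_partial_x.
- by move=> x _ _; exact: density_periodic adm _ Ov i x.
Qed.

Lemma Rintegral_partial_v s : admissible a b Omv s -> forall i x,
  \int[mu]_(v in Omv) (partial i (density s x) v * vdot v v) =
  - 2 * current Omv (density s) x ord0 i.
Proof.
move=> adm i x.
have ip := partial_v_integrable adm x i; have iq := current_integrable adm x i.
have := @integral_partial_vdot R d Omv i (density s x) oOmv
  (@within_continuous_density s adm x) (fun v => @density_derivable_v _ _ _ _ _ _ adm i x v)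
  (@continuous_partial_v s adm i x) (@density_vanishing _ _ _ _ _ _ adm x) ip iq.
move=> /(congr1 fine); rewrite -[LHS]/(\int[mu]_(v in Omv)
     (partial i (density s x) v * vdot v v + 2 * (density s x v * v ord0 i))).
rewrite RintegralD//; last first.
  by apply: (integrableZl mOmv 2 iq).
by rewrite RintegralZl// mxE /= => /eqP; rewrite addr_eq0 => /eqP ->; rewrite mulNr.
Qed.

(** Twice the kinetic energy: the factor 1/2 stands in front of both terms of [total_energy]. *)
Let kinetic s := \int[mu]_(x in box a b) \int[mu]_(v in Omv) (density s x v * vdot v v).

Let F s1 s0 (p : 'rV[R]_d * 'rV[R]_d) :=
  (density s1 p.1 p.2 - density s0 p.1 p.2) * vdot p.2 p.2.

Let iF s1 s0 : admissible a b Omv s1 -> admissible a b Omv s0 ->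
  (mu \x mu)%E.-integrable (box a b `*` Omv) (EFin \o F s1 s0).
Proof.
move=> adm1 adm0.
have mD : measurable (box a b `*` Omv) by apply: measurableX => //; exact: measurable_box.
have H := integrableB mD (energy_integrable adm1) (energy_integrable adm0).
congr (integrable _ _ _): H.
by apply/funext => p /=; rewrite /F -EFinB mulrBl.
Qed.

(** An integral over the product leaves the order free: the inner variable is [x] for scheme (a) and
    [v] for scheme (b). *)
Let kineticB s1 s0 : admissible a b Omv s1 -> admissible a b Omv s0 ->
  kinetic s1 - kinetic s0 = \int[(mu \x mu)%E]_(p in box a b `*` Omv) F s1 s0 p.
Proof.
move=> adm1 adm0.
have mB := measurable_box a b.
have mD : measurable (box a b `*` Omv) by exact: measurableX.
rewrite /kinetic (Rintegral12_setX mB mOmv (energy_integrable adm1)).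
rewrite (Rintegral12_setX mB mOmv (energy_integrable adm0)).
rewrite -RintegralB//; [|exact: energy_integrable adm1|exact: energy_integrable adm0].
by apply: eq_Rintegral => p _; rewrite /F mulrBl.
Qed.

(** At fixed [v] the weights v_i |v|^2 are constants, so testing the scheme with |v|^2 leaves only
    integrals of spatial derivatives over the periodic box. *)
Lemma scheme_a_kinetic tau s0 s1 : tau != 0 ->
  admissible a b Omv s0 -> admissible a b Omv s1 -> scheme_a Omv tau s0 s1 ->
  kinetic s1 = kinetic s0.
Proof.
move=> tau0 adm0 adm1 [Hf _]; apply/eqP; rewrite -subr_eq0 (kineticB adm1 adm0).
have mB := measurable_box a b.
rewrite -(Rintegral21_setX mB mOmv (iF adm1 adm0)).
rewrite (@eq_Rintegral _ _ _ _ _ (cst 0)) ?Rintegral_cst// ?mul0r//.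
move=> v /set_mem Ov /=.
pose c i := - tau * v ord0 i * vdot v v / 2.
transitivity (\int[mu]_(x in box a b) \sum_(i < d) (c i * (partial i (density s0 ^~ v) x
    + partial i (density s1 ^~ v) x))).
  apply: eq_Rintegral => x _; rewrite /F /=.
  have := Hf x v Ov => /eqP; rewrite addr_eq0 => /eqP.
  move/(congr1 (fun r => r * tau)); rewrite divfK// => ->.
  rewrite mulNr -mulrN mulrAC -mulrA mulr_suml; apply: eq_bigr => i _.
  rewrite mxE partial_mean; [|exact: density_derivable_x adm0 _ _ _ Ov
                             |exact: density_derivable_x adm1 _ _ _ Ov].
  by rewrite /c; field.
have ip s i : admissible a b Omv s ->
    mu.-integrable (box a b) (EFin \o partial i (density s ^~ v)).
  move=> adm; apply: continuous_box_integrable; first by move=> j; exact: ltW.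
  exact: continuous_partial_x.
rewrite Rintegral_sum//; last first.
  move=> i.
  exact: (integrableZl mB (c i) (integrableD mB (ip _ i adm0) (ip _ i adm1))).
rewrite big1// => i _.
rewrite RintegralZl//; last exact: (integrableD mB (ip _ i adm0) (ip _ i adm1)).
rewrite RintegralD//; [|exact: ip|exact: ip].
by rewrite !Rintegral_partial_x// addr0 mulr0.
Qed.

(** The balance already holds at each [x] once [v] is integrated out: the field equation turns tau/2
    (J_old + J_new) into E_old - E_new, whose product with E_old + E_new is a difference of
    squares. *)
Lemma scheme_b_kinetic tau s0 s1 : tau != 0 ->
  admissible a b Omv s0 -> admissible a b Omv s1 -> scheme_b Omv tau s0 s1 ->
  kinetic s1 - kinetic s0 =
  \int[mu]_(x in box a b) (vdot (efield s0 x) (efield s0 x) - vdot (efield s1 x) (efield s1 x)).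
Proof.
move=> tau0 adm0 adm1 [Hf HE]; rewrite (kineticB adm1 adm0).
have mB := measurable_box a b.
rewrite -(Rintegral12_setX mB mOmv (iF adm1 adm0)).
apply: eq_Rintegral => x _.
(* One factor 1/2 comes from the mean field, the other from the mean density. *)
pose c i := - tau * (efield s0 x ord0 i + efield s1 x ord0 i) / 4.
transitivity (\int[mu]_(v in Omv) \sum_(i < d) (c i * (partial i (density s0 x) v * vdot v v
    + partial i (density s1 x) v * vdot v v))).
  apply: eq_Rintegral => v /set_mem Ov; rewrite /F /=.
  have := Hf x v Ov => /eqP; rewrite addr_eq0 => /eqP.
  move/(congr1 (fun r => r * tau)); rewrite divfK// => ->.
  rewrite mulNr -mulrN mulrAC -mulrA mulr_suml; apply: eq_bigr => i _.
  rewrite !mxE partial_mean; [|exact: density_derivable_v adm0 _ _ _ Ov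
                             |exact: density_derivable_v adm1 _ _ _ Ov].
  by rewrite /c; field.
rewrite Rintegral_sum//; last first.
  move=> i.
  exact: (integrableZl mOmv (c i)
    (integrableD mOmv (partial_v_integrable adm0 x i) (partial_v_integrable adm1 x i))).
rewrite /vdot -sumrB; apply: eq_bigr => i _.
rewrite RintegralZl//; last first.
  exact: (integrableD mOmv (partial_v_integrable adm0 x i) (partial_v_integrable adm1 x i)).
rewrite RintegralD//; [|exact: partial_v_integrable adm0 x i|exact: partial_v_integrable adm1 x i].
rewrite !Rintegral_partial_v//.
have := HE x => /matrixP/(_ ord0 i); rewrite !mxE => H.
have {H} : efield s1 x ord0 i - efield s0 x ord0 i =
    - tau / 2 * (current Omv (density s0) x ord0 i + current Omv (density s1) x ord0 i).
  by rewrite !mxE -[LHS](mulVKf tau0) H; field.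
rewrite /c => H.
(* The 1/4 in [c] times the -2 of [Rintegral_partial_v] produces the tau/2 of the field equation. *)
transitivity (- (efield s0 x ord0 i + efield s1 x ord0 i) *
  (- tau / 2 * (current Omv (density s0) x ord0 i + current Omv (density s1) x ord0 i))).
  by rewrite !mxE; field.
by rewrite -H; ring.
Qed.

Lemma scheme_a_total_energy tau s0 s1 : tau != 0 ->
  admissible a b Omv s0 -> admissible a b Omv s1 -> scheme_a Omv tau s0 s1 ->
  total_energy a b Omv s0 = total_energy a b Omv s1.
Proof.
move=> tau0 adm0 adm1 Ha; rewrite /total_energy -/(kinetic s0) -/(kinetic s1).
rewrite (scheme_a_kinetic tau0 adm0 adm1 Ha); case: Ha => _ HE.
by congr (_ * (_ + _)); apply: eq_Rintegral => x _; rewrite HE.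
Qed.

Lemma scheme_b_total_energy tau s0 s1 : tau != 0 ->
  admissible a b Omv s0 -> admissible a b Omv s1 -> scheme_b Omv tau s0 s1 ->
  total_energy a b Omv s0 = total_energy a b Omv s1.
Proof.
move=> tau0 adm0 adm1 Hb; rewrite /total_energy -/(kinetic s0) -/(kinetic s1).
(* Continuity of the field makes |E|^2 integrable on the box, so the balance splits into two field
   energies. *)
have iE s : admissible a b Omv s ->
    mu.-integrable (box a b) (EFin \o (fun x => vdot (efield s x) (efield s x))).
  move=> adm; apply: continuous_box_integrable; first by move=> j; exact: ltW.
  move=> x; apply: (@continuous_comp _ _ _ (efield s) (fun w => vdot w w)).
    exact: efield_continuous adm x.
  exact: continuous_vdot.
have := scheme_b_kinetic tau0 adm0 adm1 Hb.
rewrite RintegralB//; [|exact: measurable_box|exact: iE|exact: iE].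
by move=> H; congr (_ * _); lra.
Qed.

End schemes.

Theorem theorem3p2 (R : realType) (d : nat) (hd : (0 < d)%N)
  (a b : 'rV[R]_d) (hab : forall i, a ord0 i < b ord0 i)
  (Omv : set 'rV[R]_d) (hOmv : bounded_domain Omv \/ Omv = [set: 'rV[R]_d])
  (dt : R) (hdt : 0 < dt) (s0 s1 : state R d)
  (adm0 : admissible a b Omv s0) (adm1 : admissible a b Omv s1)
  (step : scheme_4 a b Omv dt s0 s1) :
  total_energy a b Omv s0 = total_energy a b Omv s1.
Proof.
have oOmv : open Omv by case: hOmv => [[]//|->]; exact: openT.
have dt0 : dt != 0 by rewrite gt_eqF.
have dt20 : dt / 2 != 0 by rewrite gt_eqF// divr_gt0.
(* [r] and [q] are the states after the first half step of (a) and after the full step of (b). *)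
case: step => r [admr a1 [q [admq b1 a2]]].
rewrite (scheme_a_total_energy hab oOmv dt20 adm0 admr a1).
rewrite (scheme_b_total_energy hab oOmv dt0 admr admq b1).
exact: (scheme_a_total_energy hab oOmv dt20 admq adm1 a2).
Qed.
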